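(* Let $\boldsymbol{X}\sim \mathbb{ELS}(\boldsymbol{\lambda},\boldsymbol{\theta},\boldsymbol{\alpha};F_{b})$ and $\boldsymbol{Y}\sim \mathbb{ELS}(\boldsymbol{\mu},\boldsymbol{\delta},\boldsymbol{\beta};F_{b})$ be random vectors, each with independent components, where $\boldsymbol{\lambda}=\boldsymbol{\mu}=\lambda\boldsymbol{1}_{n}$ for a scalar $\lambda>0$ and $\boldsymbol{\alpha}=\boldsymbol{\beta}=\boldsymbol{1}_{n}$. Suppose that either $\boldsymbol{\theta},\boldsymbol{\delta}\in\mathcal{D}_+$ or $\boldsymbol{\theta},\boldsymbol{\delta}\in\mathcal{E}_+$, and that each of the functions $$w^2[w\tilde{r}_{b}(w)]',\quad \frac{\tilde{r}_{b}(w)}{r_{b}(w)},\quad w^2\left[\frac{\tilde{r}_{b}(w)}{r_{b}(w)}\right]',\quad w^2\left[w\left[\frac{\tilde{r}_{b}(w)}{r_{b}(w)}\right]'\right]'$$ is decreasing in $w>0$. Then $\boldsymbol{\theta}\succeq^{m}\boldsymbol{\delta}$ implies $X_{n-1:n}\leq_{rh}Y_{n-1:n}$.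
   Context: ''Increasing'' and ''decreasing'' are meant in the non-strict sense; a prime denotes the derivative (the derivatives appearing in the hypotheses are assumed to exist). All random variables are nonnegative and absolutely continuous. $F_b$ is a baseline cumulative distribution function with density $f_b$; $\tilde r_b=f_b/F_b$ is its reversed hazard rate and $r_b=f_b/(1-F_b)$ its hazard rate. $\boldsymbol{X}=(X_1,\dots,X_n)\sim\mathbb{ELS}(\boldsymbol\lambda,\boldsymbol\theta,\boldsymbol\alpha;F_b)$ (exponentiated location-scale model), with $\boldsymbol\lambda=(\lambda_1,\dots,\lambda_n)$, $\boldsymbol\theta=(\theta_1,\dots,\theta_n)$, $\boldsymbol\alpha=(\alpha_1,\dots,\alpha_n)$ having positive entries, means that $X_i$ has distribution function $F_{X_i}(x)=[F_b((x-\lambda_i)/\theta_i)]^{\alpha_i}$ for $x>\lambda_i$ (and $0$ for $x\le\lambda_i$), $i=1,\dots,n$. $X_{k:n}$ is the $k$th smallest of $X_1,\dots,X_n$, so $X_{n-1:n}$ is the second-largest order statistic. $\boldsymbol 1_n=(1,\dots,1)$. $\mathcal D_+=\{(x_1,\dots,x_n):x_1\ge x_2\ge\cdots\ge x_n>0\}$ and $\mathcal E_+=\{(x_1,\dots,x_n):0<x_1\le x_2\le\cdots\le x_n\}$. For vectors $\boldsymbol x,\boldsymbol y$ with increasing rearrangements $x_{1:n}\le\cdots\le x_{n:n}$ and $y_{1:n}\le\cdots\le y_{n:n}$, $\boldsymbol y\succeq^m\boldsymbol x$ ($\boldsymbol x$ is majorized by $\boldsymbol y$) means $\sum_{i=1}^k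 x_{i:n}\ge\sum_{i=1}^k y_{i:n}$ for all $k=1,\dots,n-1$ and $\sum_{i=1}^n x_{i:n}=\sum_{i=1}^n y_{i:n}$. For a random variable $U$ with density $f_U$ and distribution function $F_U$, let $\tilde r_U=f_U/F_U$; $U\le_{rh}V$ (reversed hazard rate order) means $\tilde r_U(x)\le\tilde r_V(x)$ for all $x>0$ (at which both are defined). *)

(* Defs.v *)
From HB Require Import structures.
From mathcomp Require Import all_boot all_order all_algebra.
From mathcomp Require Import all_classical all_reals all_analysis.

Set Implicit Arguments.
Unset Strict Implicit.
Unset Printing Implicit Defensive.

Import Order.TTheory GRing.Theory Num.Theory.
Import numFieldNormedType.Exports.

Local Open Scope classical_set_scope.
Local Open Scope ring_scope.

(* [kth_smallest k x] is x_{k:n}; the index k is counted from 1, as on paper. *)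
Definition kth_smallest (R : realType) (n k : nat) (x : 'I_n -> R) : R :=
  nth 0 (sort <=%R (codom x)) k.-1.

(* The event X_{k:n} > r: at most k - 1 of the X_i are <= r. *)
Lemma kth_smallest_gt (R : realType) (n k : nat) (x : 'I_n -> R) (r : R) :
  (k.-1 < n)%N ->
  (r < kth_smallest k x) = (#|[pred i | (x i <= r)%R]| <= k.-1)%N.
Proof.
move=> kn; rewrite /kth_smallest.
have ss : sorted <=%R (sort <=%R (codom x)) by exact/sort_sorted/le_total.
have sz : size (sort <=%R (codom x)) = n.
  by rewrite size_sort size_codom card_ord.
have ct : count (fun y => y <= r) (sort <=%R (codom x)) =
    #|[pred i | (x i <= r)%R]|.
  rewrite (permP (permEl (perm_sort _ _))) /codom /image_mem count_map.
  by rewrite cardE -size_filter enumT.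
apply/idP/idP => [|h]; last by apply: nth_count_gt => //; rewrite ct sz h.
by apply: contraTT; rewrite -ltnNge -ct -leNgt => h; exact: nth_count_le.
Qed.

Section order_statistics.
Context d (T : measurableType d) (R : realType) (P : probability T R).
Context (n k : nat) (X : 'I_n -> {RV P >-> R}).

Definition order_statistic_fun (t : T) : R := kth_smallest k (fun i => X i t).

Lemma measurable_order_statistic : measurable_fun [set: T] order_statistic_fun.
Proof.
have [kn|nk] := ltnP k.-1 n; last first.
  rewrite (_ : order_statistic_fun = cst 0); first exact: measurable_cst.
  apply/funext => t; rewrite /order_statistic_fun /kth_smallest nth_default//.
  by rewrite size_sort size_codom card_ord.
move=> _; apply: (measurability _ (measurable_realfun.RGenOInfty.measurableE R)) => //.
move=> /= _ [_] [r ->] <-; rewrite setTI.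
rewrite [X in measurable X](_ : _ = \bigcup_(A in [set A : {set 'I_n} |
    (#|A| <= k.-1)%N]) \bigcap_(i in [set i | i \notin A])
    (X i @^-1` `]r, +oo[)).
  apply: fin_bigcup_measurable => [|A _]; first exact: finite_finset.
  apply: fin_bigcap_measurable => [|i _]; first exact: finite_finset.
  rewrite -[X in measurable X]setTI.
  exact: (measurable_funP (X i)).
apply/seteqP; split => t /=.
  rewrite in_itv/= andbT kth_smallest_gt// => h.
  exists [set i | X i t <= r]%SET => /=; first by rewrite cardsE.
  by move=> i /=; rewrite inE -ltNge in_itv/= andbT.
move=> [A /= Ak h]; rewrite in_itv/= andbT kth_smallest_gt//.
apply: leq_trans Ak; apply/subset_leq_card/fintype.subsetP => i; rewrite inE => xi.
apply: contraLR xi => /h /=; by rewrite in_itv/= andbT ltNge.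
Qed.

HB.instance Definition _ := isMeasurableFun.Build _ _ _ _
  order_statistic_fun measurable_order_statistic.

Definition order_statistic : {RV P >-> R} := order_statistic_fun.

End order_statistics.

(* Mutual independence: the product rule for every finite subfamily. *)
Definition independent_components d (T : measurableType d) (R : realType)
    (P : probability T R) (n : nat) (X : 'I_n -> {RV P >-> R}) : Prop :=
  forall (J : {set 'I_n}) (A : 'I_n -> set R),
    (forall i, i \in J -> measurable (A i)) ->
    P (\bigcap_(i in [set` J]) (X i @^-1` A i)) =
    (\prod_(i in J) P (X i @^-1` A i))%E.

(* F is the cumulative distribution function, and f a Lebesgue density, of an
   absolutely continuous nonnegative random variable. *)
Definition nonneg_abs_continuous (R : realType) (F f : R -> R) : Prop :=
  [/\ measurable_fun [set: R] f,
      forall x, 0 <= f x,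
      (\int[lebesgue_measure]_x (f x)%:E = 1)%E,
      forall x, ((F x)%:E = \int[lebesgue_measure]_(t in `]-oo, x]) (f t)%:E)%E
    & F 0 = 0].

(* Division is total, with y / 0 = 0. If F and f are as above and the ratio of
   the two rates is decreasing and differentiable on w > 0, with
   w^2 times its derivative also decreasing there, then 0 < F w < 1 and 0 < f w
   for all w > 0, so no convention on division by zero is then at play. *)
Definition reversed_hazard_rate (R : realType) (F f : R -> R) (x : R) : R :=
  f x / F x.

Definition hazard_rate (R : realType) (F f : R -> R) (x : R) : R :=
  f x / (1 - F x).

Definition hazard_ratio (R : realType) (F f : R -> R) (x : R) : R :=
  reversed_hazard_rate F f x / hazard_rate F f x.

Definition real_cdf d (T : measurableType d) (R : realType)
    (P : probability T R) (X : {RV P >-> R}) (x : R) : R := fine (cdf X x).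

Definition is_ELS d (T : measurableType d) (R : realType)
    (P : probability T R) (n : nat) (X : 'I_n -> {RV P >-> R})
    (lambda theta alpha : 'I_n -> R) (Fb : R -> R) : Prop :=
  (forall i, [/\ 0 < lambda i, 0 < theta i & 0 < alpha i]) /\
  (forall i x, real_cdf (X i) x =
    if lambda i < x then Fb ((x - lambda i) / theta i) `^ alpha i else 0).

Definition D_plus (R : realType) (n : nat) (x : 'I_n -> R) : Prop :=
  (forall i, 0 < x i) /\ (forall i j : 'I_n, (i <= j)%N -> x j <= x i).

Definition E_plus (R : realType) (n : nat) (x : 'I_n -> R) : Prop :=
  (forall i, 0 < x i) /\ (forall i j : 'I_n, (i <= j)%N -> x i <= x j).

(* [majorizes y x]: y majorizes x, i.e. x is majorized by y. *)
Definition majorizes (R : realType) (n : nat) (y x : 'I_n -> R) : Prop :=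
  (forall k, (1 <= k <= n.-1)%N ->
    \sum_(1 <= i < k.+1) kth_smallest i y <=
    \sum_(1 <= i < k.+1) kth_smallest i x) /\
  \sum_(1 <= i < n.+1) kth_smallest i x = \sum_(1 <= i < n.+1) kth_smallest i y.

(* The density of U at x is the derivative of its distribution function, and
   its reversed hazard rate is defined at the points x where this derivative
   exists and F_U(x) > 0. *)
Definition rh_defined d (T : measurableType d) (R : realType)
    (P : probability T R) (U : {RV P >-> R}) (x : R) : Prop :=
  derivable (real_cdf U) x 1 /\ 0 < real_cdf U x.

Definition rh_le d (T : measurableType d) (R : realType) (P : probability T R)
    d' (T' : measurableType d') (Q : probability T' R)
    (U : {RV P >-> R}) (V : {RV Q >-> R}) : Prop :=
  forall x : R, 0 < x -> rh_defined U x -> rh_defined V x ->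
    reversed_hazard_rate (real_cdf U) (derive1 (real_cdf U)) x <=
    reversed_hazard_rate (real_cdf V) (derive1 (real_cdf V)) x.

(* Main.v *)
Require Import Defs.
From mathcomp Require Import all_boot all_order all_algebra.
From mathcomp Require Import all_classical all_reals all_analysis.
From mathcomp Require Import measurable_realfun ring lra zify.

(** Write t = x - l and w_i = t / theta_i, and let F be the baseline
    distribution function with density f, r = f / F its reversed hazard rate
    and h = (1 - F) / F the ratio of its reversed hazard rate to its hazard
    rate. At most one X_i exceeds x exactly when the second-largest X_i is at
    most x, so independence gives the distribution function
    [prod_i F (w_i) + sum_i (1 - F (w_i)) prod_(j != i) F (w_j)
       = prod_i F (w_i) * (1 + sum_i h (w_i))],
    whose logarithmic derivative at x is (A + B / C) / t, where
    [A = sum_i w_i r (w_i)], [B = sum_i w_i h' (w_i)], [C = 1 + sum_i h (w_i)]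
    (second_largest_cdf, second_largest_rh).

    The derivative of theta |-> k (t / theta) is - w^2 k' (w) / t at
    w = t / theta, so when w^2 k' (w) decreases in w this function of theta is
    concave (recip_scale_concave). Three of the monotonicity hypotheses say
    this of k = w r, h and w h'. Karamata's inequality (karamata) then makes
    A, B and C grow when theta is replaced by a vector that it majorizes. As h
    decreases, B <= 0; as C > 0, enlarging C also enlarges B / C. Hence
    A + B / C grows, which is the claim.

    The ratio of rates is h = (1 - F) / F only where F and 1 - F and f are
    nonzero, and the density is the derivative of F only where it is
    continuous. Both hold at every w > 0: the ratio of rates is nonnegative,
    and at a zero it would have a minimum, so theta |-> h (1 / theta), being
    concave, would be at most 0 everywhere, forcing the density to vanish
    wherever 0 < F < 1, against the continuity of F (hazard_ratio_gt0).
    Then F > 0, and differentiability of w r (w) makes f continuous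
    (density_continuous). *)

Set Implicit Arguments.
Unset Strict Implicit.
Unset Printing Implicit Defensive.

Import Order.TTheory GRing.Theory Num.Theory.
Import numFieldNormedType.Exports.

Local Open Scope classical_set_scope.
Local Open Scope ring_scope.

(** * The distribution of the second-largest order statistic *)

(** The order statistic of rank n - 1 is at most r iff at least n - 1 of the n
    values are at most r, that is, iff no two of them exceed r. *)
Lemma second_largest_leP (R : realType) (n : nat) (x : 'I_n -> R) (r : R) :
  (2 <= n)%N ->
  reflect (forall i j, r < x i -> r < x j -> i = j)
    (kth_smallest n.-1 x <= r).
Proof.
move=> n2; have n1 : (n.-2 < n)%N by case: n n2 {x} => [|[|n']].
rewrite leNgt kth_smallest_gt// -ltnNge.
have cE : (n = #|[pred i | (x i <= r)%R]| + #|[pred i | (r < x i)%R]|)%N.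
  rewrite -[LHS]card_ord -(cardC [pred i | (x i <= r)%R]); congr addn.
  by apply: eq_card => i; rewrite !inE ltNge.
have -> : (n.-2 < #|[pred i | (x i <= r)%R]|)%N =
          (#|[pred i | (r < x i)%R]| <= 1)%N by lia.
apply: (iffP fintype.card_le1_eqP) => H i j.
  by move=> ri rj; apply: H; rewrite inE.
by rewrite !inE => ri rj; exact: H.
Qed.

Section second_largest.
Context d (T : measurableType d) (R : realType) (P : probability T R).
Context (n : nat) (X : 'I_n -> {RV P >-> R}).
Context (indX : independent_components X).
Context (n2 : (2 <= n)%N).

(** The option records which index, if any, is the only one to exceed x, so
    that the event of at most one exceedance splits into disjoint boxes. *)
Let side (x : R) (o : option 'I_n) (i : 'I_n) : set R :=
  if o == Some i then `]x, +oo[%classic else `]-oo, x]%classic.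

Let exceed (x : R) (o : option 'I_n) : set T :=
  \bigcap_(i in [set` [set: 'I_n]%SET]) (X i @^-1` side x o i).

Let mside x o i : measurable (side x o i).
Proof. by rewrite /side; case: ifP. Qed.

Let mexceed x o : measurable (exceed x o).
Proof.
apply: fin_bigcap_measurable => [|i _]; first exact: finite_finset.
by rewrite -[X in measurable X]setTI; exact: (measurable_funP (X i)).
Qed.

Let P_side x o i : P (X i @^-1` side x o i) =
  (if o == Some i then 1 - real_cdf (X i) x else real_cdf (X i) x)%:E.
Proof.
have fin : P (X i @^-1` `]-oo, x]) = (real_cdf (X i) x)%:E.
  by rewrite /real_cdf fineK//; exact: fin_num_measure.
rewrite /side; case: ifP => // _.
rewrite EFinB -fin -probability_setC; last first.
  by rewrite -[X in measurable X]setTI; exact: (measurable_funP (X i)).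
by congr (P _); rewrite preimage_setC setCitvl.
Qed.

Lemma second_largest_event x :
  order_statistic n.-1 X @^-1` `]-oo, x] =
  \bigcup_(o in [set: option 'I_n]) exceed x o.
Proof.
apply/seteqP; split => t /=; rewrite in_itv/=.
  move/second_largest_leP => /(_ n2) H.
  have [[j xj]|none] := pselect (exists j, x < X j t).
    exists (Some j) => // i _; rewrite /side /=.
    case: eqP => [[<-]|ji] /=; rewrite in_itv/= ?andbT//.
    by rewrite leNgt; apply/negP => /(H _ _ xj) ji'; apply: ji; rewrite ji'.
  exists None => // i _; rewrite /side /= in_itv/= leNgt.
  by apply/negP => xi; apply: none; exists i.
case=> o _ H; apply/second_largest_leP => // i j xi xj.
have big_out k : x < X k t -> o = Some k.
  move=> xk; have := H k; rewrite /= inE /side => /(_ isT).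
  by case: eqP => // _; rewrite /= in_itv/= leNgt xk.
by have := big_out _ xi; rewrite (big_out _ xj) => -[].
Qed.

Let exceed_disjoint x : trivIset [set: option 'I_n] (exceed x).
Proof.
apply/trivIsetP => o o' _ _ oo'; rewrite -subset0 => t [H H'].
have out i (s s' : option 'I_n) : exceed x s t -> exceed x s' t ->
    s = Some i -> s' = Some i.
  move=> /(_ i) + /(_ i); rewrite /= inE => /(_ isT) + /(_ isT) + se.
  rewrite /side se eqxx; case: (s' =P Some i) => //= _.
  by rewrite !in_itv/= andbT leNgt => ->.
case: o o' oo' H H' => [i|] [j|] //= /eqP oo' H H'.
- by apply: oo'; rewrite (out i _ _ H H' erefl).
- by have := out i _ _ H H' erefl.
- by have := out j _ _ H' H erefl.
Qed.

(** The boxes [exceed x o] are disjoint, and independence factors the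
    probability of each: the first term is the box where no component exceeds
    x, the i-th summand the box where only the i-th does. *)
Lemma second_largest_cdf x : real_cdf (order_statistic n.-1 X) x =
  \prod_i real_cdf (X i) x +
  \sum_i (1 - real_cdf (X i) x) * \prod_(j | j != i) real_cdf (X j) x.
Proof.
have PE o : P (exceed x o) = (\prod_i
      (if o == Some i then 1 - real_cdf (X i) x else real_cdf (X i) x))%:E.
  rewrite indX// -prodEFin.
  by apply: eq_big => i; rewrite ?inE// P_side.
rewrite {1}/real_cdf /cdf /distribution /pushforward second_largest_event.
rewrite measure_fin_bigcup//; last exact: finite_finset.
rewrite (@fsbigE _ _ _ _ _ (None :: map Some (enum 'I_n))); first last.
- move=> i _; rewrite !inE; case: i => // i.
  by rewrite mem_map ?mem_enum// => ? ? [].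
- by move=> i.
- rewrite /= map_inj_uniq ?enum_uniq ?andbT; last by move=> ? ? [].
  by apply/negP => /mapP[].
rewrite (eq_bigr _ (fun o _ => PE o)) sumEFin/=.
rewrite big_mkcond/= big_cons big_map big_enum/= in_setT; congr +%R.
apply: eq_bigr => i _; rewrite in_setT (bigD1 i)//= eqxx; congr *%R.
by apply: eq_bigr => j ji; case: eqP => // -[ij]; rewrite ij eqxx in ji.
Qed.

End second_largest.

(** * Majorization and Karamata's inequality *)

Lemma sum_kth_smallest (R : realType) (n : nat) (x : 'I_n -> R) (phi : R -> R) :
  \sum_(1 <= i < n.+1) phi (kth_smallest i x) = \sum_(i < n) phi (x i).
Proof.
rewrite big_add1 /= /kth_smallest/=.
have sz : size (sort <=%R (codom x)) = n.
  by rewrite size_sort size_codom card_ord.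
transitivity (\sum_(0 <= i < size (sort <=%R (codom x)))
    phi (sort <=%R (codom x))`_i); first by rewrite sz.
rewrite -(big_nth 0 predT phi).
by rewrite (perm_big _ (permEl (perm_sort _ _))) /= big_map enumT.
Qed.

Lemma kth_smallest_pos (R : realType) (n i : nat) (x : 'I_n -> R) :
  (forall j, 0 < x j) -> (1 <= i <= n)%N -> 0 < kth_smallest i x.
Proof.
move=> x0 /andP[i1 iin].
have : kth_smallest i x \in codom x.
  rewrite -(mem_sort <=%R) /kth_smallest mem_nth//.
  by rewrite size_sort size_codom card_ord prednK.
by case/codomP => j ->.
Qed.

Lemma kth_smallest_le (R : realType) (n i j : nat) (x : 'I_n -> R) :
  (i <= j <= n)%N -> (0 < n)%N -> kth_smallest i x <= kth_smallest j x.
Proof.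
move=> /andP[ij jn] n0.
have sz : size (sort <=%R (codom x)) = n.
  by rewrite size_sort size_codom card_ord.
have jlt : (j.-1 < n)%N by case: j jn {ij}.
apply: (sorted_leq_nth le_trans lexx) => //.
- by apply: sort_sorted; exact: le_total.
- by rewrite inE sz (leq_ltn_trans _ jlt)// -!subn1 leq_sub2r.
- by rewrite inE sz.
- by rewrite -!subn1 leq_sub2r.
Qed.

(** Summation by parts: the partial sums of d are weighted by the nonnegative
    differences c i - c i.+1, and the total sum of d, weighted by the last
    value of c, vanishes. *)
Lemma abel_sum_le0 (R : realDomainType) (c d : nat -> R) (n : nat) :
  (forall i, (i.+1 < n)%N -> c i.+1 <= c i) ->
  (forall k, (k < n)%N -> \sum_(i < k) d i <= 0) -> \sum_(i < n) d i = 0 ->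
  \sum_(i < n) c i * d i <= 0.
Proof.
case: n => [|n] cc dd d0; first by rewrite big_ord0.
suff H m : (m <= n)%N ->
    \sum_(i < m.+1) c i * d i <= c m * \sum_(i < m.+1) d i.
  by rewrite (le_trans (H _ (leqnn n)))// d0 mulr0.
(* Replacing c m by c m.+1 can only raise the product, since the partial sum
   that it multiplies is nonpositive. *)
elim: m => [|m IH] mn; first by rewrite !big_ord_recr !big_ord0 /= !add0r.
rewrite big_ord_recr/= [X in _ <= _ * X]big_ord_recr/= mulrDr lerD2r.
apply: (le_trans (IH (ltnW mn))).
by apply: ler_wnM2r; [exact: dd|exact: cc].
Qed.

(** A concave phi enters through a supergradient c. The tangent inequality,
    applied to the sorted vectors entry by entry, reduces the claim to a sum
    of c (x_(i)) (y_(i) - x_(i)), where c (x_(i)) decreases in i and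
    majorization says that the partial sums of the differences are nonpositive
    and their total is 0. *)
Lemma karamata (R : realType) (n : nat) (phi c : R -> R) (x y : 'I_n -> R) :
  (forall a b, 0 < a -> 0 < b -> phi a - phi b <= c b * (a - b)) ->
  (forall a b, 0 < a -> a <= b -> c b <= c a) ->
  (forall i, 0 < x i) -> (forall i, 0 < y i) -> majorizes y x ->
  \sum_(i < n) phi (y i) <= \sum_(i < n) phi (x i).
Proof.
move=> tan cc x0 y0 [maj majn].
case: n => [|n] in x y x0 y0 maj majn *; first by rewrite !big_ord0.
rewrite -!(sum_kth_smallest _ phi) !big_add1 /= -subr_le0 -sumrB.
rewrite big_mkord.
pose d i := kth_smallest i.+1 y - kth_smallest i.+1 x.
apply: (@le_trans _ _ (\sum_(i < n.+1) c (kth_smallest i.+1 x) * d i)).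
  apply: ler_sum => i _; apply: tan;
    by apply: kth_smallest_pos; rewrite // ltn_ord.
apply: (abel_sum_le0 (c := fun i => c (kth_smallest i.+1 x))) => [i ilt|k kn|].
- apply: cc; first by apply: kth_smallest_pos => //=; exact: ltnW.
  by apply: kth_smallest_le => //; rewrite leqnSn.
- case: k kn => [|k] kn; first by rewrite big_ord0.
  rewrite /d sumrB subr_le0.
  have := maj k.+1; rewrite /= in kn *; move=> /(_ _).
  by rewrite !big_add1 /= !big_mkord; exact.
- by move: majn; rewrite !big_add1 /= !big_mkord /d sumrB => ->; rewrite subrr.
Qed.

(** * Concavity in the scale parameter *)

(** With w = t / th, the derivative of k (t / th) in th is
    c th = - w^2 k' w / t. It decreases in th because w does, and the mean value
    theorem turns it into a supergradient. *)
Lemma recip_scale_concave (R : realType) (k k' : R -> R) (t : R) :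
  0 < t ->
  (forall w : R, 0 < w -> is_derive w 1 k (k' w)) ->
  {in `]0, +oo[ &, nonincreasing_fun (fun w : R => w ^+ 2 * k' w)} ->
  let c := fun th : R => - ((t / th) ^+ 2 * k' (t / th)) / t in
  (forall a b, 0 < a -> 0 < b -> k (t / a) - k (t / b) <= c b * (a - b)) /\
  (forall a b, 0 < a -> a <= b -> c b <= c a).
Proof.
move=> t0 dk nonin c.
have pos_in (w : R) : (w \in `]0, +oo[) = (0 < w) by rewrite in_itv/= andbT.
have cmon a b : 0 < a -> a <= b -> c b <= c a.
  move=> a0 ab; have b0 := lt_le_trans a0 ab.
  rewrite /c ler_pM2r ?invr_gt0// lerN2.
  apply: nonin; rewrite ?pos_in ?divr_gt0//.
  by rewrite ler_pM2l// lef_pV2 ?posrE.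
pose phi (th : R) := k (t / th).
have dphi (th : R) : 0 < th -> is_derive th 1 phi (c th).
  move=> th0.
  have thn0 : th != 0 by rewrite gt_eqF.
  have dt : is_derive th 1 (fun u : R => t / u) (- (t / th ^+ 2)).
    have -> : (fun u : R => t / u) = t \*: (fun u : R => u^-1) by [].
    apply: is_derive_eq; first by apply: is_deriveZ; exact: is_deriveV.
    by rewrite /GRing.scale /=; field.
  have D := @is_derive1_comp _ k (fun u : R => t / u) th _ _
    (dk _ (divr_gt0 t0 th0)) dt.
  apply: (is_derive_eq D); rewrite /c.
  have tn0 : t != 0 by rewrite gt_eqF.
  by field; rewrite thn0 tn0.
have mvt a b : 0 < a -> a < b ->
    exists2 u, u \in `]a, b[ & phi b - phi a = c u * (b - a).
  move=> a0 ab; apply: MVT => // [u|].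
    by rewrite in_itv/= => /andP[au _]; apply: dphi; exact: lt_trans au.
  apply: continuous_in_subspaceT => u; rewrite inE/= in_itv/= => /andP[au _].
  apply: differentiable_continuous; apply/derivable1_diffP.
  by have [] := dphi _ (lt_le_trans a0 au).
split => // a b a0 b0.
have [ab|ba|->] := ltgtP a b; last by rewrite !subrr mulr0.
- have [u] := mvt _ _ a0 ab; rewrite in_itv/= => /andP[au ub] E.
  rewrite -/(phi a) -/(phi b) -[phi a - phi b]opprB -[a - b]opprB E mulrN lerN2.
  rewrite ler_pM2r ?subr_gt0//; apply: cmon (ltW ub).
  exact: lt_trans au.
- have [u] := mvt _ _ b0 ba; rewrite in_itv/= => /andP[bu ua] E.
  by rewrite -/(phi a) -/(phi b) E ler_pM2r ?subr_gt0//; exact: cmon (ltW bu).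
Qed.

Lemma majorizes_scale_sum (R : realType) (n : nat) (k : R -> R) (t : R)
    (x y : 'I_n -> R) :
  0 < t -> (forall w : R, 0 < w -> derivable k w 1) ->
  {in `]0, +oo[ &, nonincreasing_fun (fun w : R => w ^+ 2 * derive1 k w)} ->
  (forall i, 0 < x i) -> (forall i, 0 < y i) -> majorizes y x ->
  \sum_i k (t / y i) <= \sum_i k (t / x i).
Proof.
move=> t0 dk k_dec x0 y0 yx.
have dk1 (w : R) : 0 < w -> is_derive w 1 k (derive1 k w).
  by move=> w0; rewrite derive1E; exact/derivableP/dk.
have [tan cmon] := recip_scale_concave t0 dk1 k_dec.
exact: (karamata (phi := fun th => k (t / th)) tan cmon).
Qed.

(** * Absolutely continuous distribution functions *)

Section abs_continuous_cdf.
Context (R : realType) (F f : R -> R).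
Context (Ff : nonneg_abs_continuous F f).
Notation mu := (@lebesgue_measure R).

Lemma density_integrable (D : set R) :
  measurable D -> mu.-integrable D (EFin \o f).
Proof.
have [mf f0 f1 _ _] := Ff => mD.
apply: (@integrableS _ _ _ _ setT) => //.
apply/integrableP; split; first exact/measurable_EFinP.
under eq_integral do rewrite /= ger0_norm//.
by rewrite f1 ltry.
Qed.

Lemma cdfB (a b : R) : a <= b -> F b - F a = (\int[mu]_(t in `[a, b]) f t)%R.
Proof.
have [mf f0 f1 FE _] := Ff => ab.
have E x : F x = (\int[mu]_(t in `]-oo, x]) f t)%R.
  by rewrite /Rintegral -FE.
rewrite !E Rintegral_itvB//; last exact: density_integrable.
by rewrite Rintegral_itv_obnd_cbnd//; exact: density_integrable.
Qed.

Lemma cdf_nondec (a b : R) : a <= b -> F a <= F b.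
Proof.
have [mf f0 _ _ _] := Ff => ab; rewrite -subr_ge0 cdfB//.
by apply: Rintegral_ge0.
Qed.

Lemma cdf_bounds (x : R) : 0 <= F x <= 1.
Proof.
have [mf f0 f1 FE _] := Ff.
have mEf : measurable_fun [set: R] (EFin \o f) by exact/measurable_EFinP.
rewrite -!lee_fin FE -f1; apply/andP; split.
  by apply: integral_ge0 => t _; rewrite lee_fin.
by apply: ge0_subset_integral => // t _; rewrite lee_fin.
Qed.

Lemma cdf_continuous_ge0 (b : R) : 0 <= b -> {within `[0, b], continuous F}.
Proof.
have [_ _ _ _ F0] := Ff => b0.
have := @parameterized_integral_continuous R 0 b f b0
  (density_integrable (measurable_itv _)).
apply: subspace_eq_continuous => x; rewrite inE/= in_itv/= => /andP[x0 _].
by rewrite /parameterized_integral /from_subspace -cdfB// F0 subr0.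
Qed.

Lemma is_derive_cdf (w : R) :
  {for w, continuous f} -> is_derive w 1 F (f w).
Proof.
have [_ _ _ FE _] := Ff => cf.
have FR : F = (fun x => \int[mu]_(t in `]-oo, x]) f t)%R.
  by apply/funext => x; rewrite /Rintegral -FE.
have [dF <-] : derivable F w 1 /\ derive1 F w = f w.
  rewrite FR; apply: (@continuous_FTC1 _ f -oo%O w (w + 1)) => //.
  - by rewrite ltrDl.
  - exact: density_integrable.
  - exact: ltNyr.
by rewrite derive1E; exact: DeriveDef.
Qed.

Lemma cvg_cdfn : F n%:R @[n --> \oo] --> (1 : R).
Proof.
have [mf f0 f1 FE _] := Ff.
have U : \bigcup_n [set` `]-oo, (n%:R : R)]] = [set: R].
  rewrite -subTset => t _; exists (Num.trunc t).+1 => //=.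
  by rewrite in_itv/= ltW// truncnS_gt.
have -> : (fun n : nat => F n%:R) =
    (fun n : nat => fine (\int[mu]_(t in [set` `]-oo, n%:R]]) (f t)%:E)%E).
  by apply/funext => n; rewrite -FE.
apply: fine_cvg; rewrite -f1 -U.
apply: (@ge0_nondecreasing_set_cvg_integral _ (measurableTypeR R) R
  (fun n : nat => [set` `]-oo, (n%:R : R)]]) (EFin \o f) mu) => //.
- move=> m n mn; apply/subsetPset => x/=; rewrite !in_itv/= => /le_trans.
  by apply; rewrite ler_nat.
- by move=> n; apply/measurable_EFinP; exact: measurable_funTS.
- by move=> n x _; rewrite lee_fin.
Qed.

(** F runs continuously from 0 at 0 to 1 at infinity. *)
Lemma cdf_between (v : R) : 0 < v < 1 -> exists2 w, 0 < w & F w = v.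
Proof.
have [_ _ _ _ F0] := Ff => /andP[v0 v1].
have [b b0 Fb] : exists2 b, 0 < b & v <= F b.
  have [N _ vF] := cvgr_ge 1 cvg_cdfn _ v1.
  by exists N.+1%:R; rewrite ?ltr0n//; apply: vF => /=.
have [|c] := IVT (ltW b0) (cdf_continuous_ge0 (ltW b0)) (v := v).
  have Fb0 : 0 <= F b := le_trans (ltW v0) Fb.
  by rewrite F0 min_l// max_r// (ltW v0) Fb.
rewrite in_itv/= => /andP[c0 cb] Fc; exists c => //.
rewrite lt_neqAle c0 andbT; apply: contraTneq v0 => c00.
by rewrite -Fc -c00 F0 ltxx.
Qed.

End abs_continuous_cdf.

(** * The baseline distribution: F, 1 - F and f are positive on the half-line *)

Section baseline.
Context (R : realType) (F f : R -> R).
Context (Ff : nonneg_abs_continuous F f).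
Notation h := (hazard_ratio F f).
Context (dh : forall w : R, 0 < w -> derivable h w 1).
Context (h_dec : {in `]0, +oo[ &, nonincreasing_fun (fun w : R =>
  w ^+ 2 * derive1 h w)}).

Lemma hazard_ratio_ge0 (w : R) : 0 <= h w.
Proof.
have [_ f0 _ _ _] := Ff; have /andP[F0 F1] := cdf_bounds Ff w.
by rewrite /hazard_ratio !divr_ge0// ?subr_ge0.
Qed.

Lemma hazard_ratioE w : 0 < F w -> F w < 1 -> f w != 0 -> h w = (F w)^-1 - 1.
Proof.
move=> F0 F1 f0.
rewrite /hazard_ratio /reversed_hazard_rate /hazard_rate.
by field; rewrite f0 gt_eqF//= gt_eqF// subr_gt0.
Qed.

(** A zero of the ratio would be a minimum, so its derivative would vanish
    there; the concave function th |-> h (1 / th) would have a horizontal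
    tangent at height 0, hence be at most 0, and the ratio would vanish on the
    whole half-line. Then f = 0 wherever 0 < F < 1, so F could not increase
    from 1/4 to 1/2. *)
Lemma hazard_ratio_gt0 (w : R) : 0 < w -> 0 < h w.
Proof.
move=> w0; rewrite lt_neqAle hazard_ratio_ge0 andbT; apply/eqP => /esym hw.
have ispd (v : R) : 0 < v -> is_derive v 1 h (derive1 h v).
  by move=> v0; rewrite derive1E; exact/derivableP/dh.
(* The interval is any one around w inside the half-line. *)
have h'w : derive1 h w = 0.
  rewrite derive1E.
  have [] := @derive1_at_min _ h (w / 2) (w * 2) w _ _ _ _ => //.
  - by lra.
  - move=> t; rewrite in_itv/= => /andP[wt _]; apply: dh; lra.
  - by rewrite in_itv/=; apply/andP; split; lra.
  - by move=> t _; rewrite hw hazard_ratio_ge0.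
have h0 (v : R) : 0 < v -> h v = 0.
  move=> v0; apply/eqP; rewrite eq_le hazard_ratio_ge0 andbT.
  have [tan _] := recip_scale_concave ltr01 ispd h_dec.
  have := tan v^-1 w^-1; rewrite !invr_gt0 => /(_ v0 w0).
  by rewrite !div1r !invrK h'w mulr0 oppr0 mul0r hw subr0 mul0r.
have [|w1 w10 Fw1] := cdf_between Ff (v := 4^-1); first by lra.
have [|w2 w20 Fw2] := cdf_between Ff (v := 2^-1); first by lra.
have w12 : w1 <= w2.
  by rewrite leNgt; apply/negP => /ltW/(cdf_nondec Ff); lra.
have := cdfB Ff w12; rewrite (_ : Rintegral _ _ _ = 0); first by lra.
under eq_Rintegral.
  move=> t; rewrite inE/= in_itv/= => /andP[w1t tw2].
  have f0 : f t = 0.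
    have Ft1 := cdf_nondec Ff w1t; have Ft2 := cdf_nondec Ff tw2.
    apply: contrapT => /eqP ft; have : 0 < t by lra.
    move=> /h0; rewrite hazard_ratioE//; [|lra|lra].
    have : 1 < (F t)^-1 by rewrite invf_gt1//; lra.
    lra.
  by rewrite f0; over.
by rewrite Rintegral_cst// mul0r.
Qed.

(** Where F vanishes, so does the ratio of rates, since 0^-1 = 0. *)
Lemma cdf_gt0 (w : R) : 0 < w -> 0 < F w.
Proof.
move=> /hazard_ratio_gt0; have /andP[F0 _] := cdf_bounds Ff w.
rewrite [in X in _ -> X]lt_neqAle F0 andbT; apply: contraTneq => F0w.
by rewrite /hazard_ratio /reversed_hazard_rate -F0w invr0 mulr0 mul0r ltxx.
Qed.

(** Multiplied out, the identity h = (1 - F) / F; if f vanished or F reached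
    1, the ratio of rates would be 0 because 0^-1 = 0. *)
Lemma hazard_ratio_cdf (w : R) : 0 < w -> 1 - F w = F w * h w.
Proof.
move=> w0; have hw := hazard_ratio_gt0 w0; have Fw := cdf_gt0 w0.
have [fw|fw] := eqVneq (f w) 0.
  by move: hw; rewrite /hazard_ratio /reversed_hazard_rate fw !mul0r ltxx.
have [Fw1|Fw1] := eqVneq (F w) 1.
  move: hw; rewrite /hazard_ratio /hazard_rate Fw1.
  by rewrite subrr invr0 mulr0 invr0 mulr0 ltxx.
rewrite hazard_ratioE//; first by field; rewrite gt_eqF.
by have /andP[_ ?] := cdf_bounds Ff w; rewrite lt_neqAle Fw1.
Qed.

Lemma cdf_continuous (w : R) : 0 < w -> {for w, continuous F}.
Proof.
move=> w0; have w20 : 0 <= w + 1 by lra.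
apply: (within_continuous_continuous _ (cdf_continuous_ge0 Ff w20)); first lra.
by rewrite in_itv/= w0 ltrDl/=.
Qed.

Context (dr : forall w : R, 0 < w ->
  derivable (fun v : R => v * reversed_hazard_rate F f v) w 1).

(** The density is w r (w) times F (w) / w, both factors continuous. *)
Lemma density_continuous (w : R) : 0 < w -> {for w, continuous f}.
Proof.
move=> w0.
pose g := (fun v : R => v * reversed_hazard_rate F f v) \* (F \* @GRing.inv R).
have cg : {for w, continuous g}.
  apply: continuousM.
    by apply: differentiable_continuous; apply/derivable1_diffP/dr.
  apply: continuousM; first exact: cdf_continuous.
  by apply: inv_continuous; rewrite gt_eqF.
have E (v : R) : 0 < v -> g v = f v.
  move=> v0; rewrite /g /= /reversed_hazard_rate; field.
  by rewrite !gt_eqF// cdf_gt0.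
rewrite /prop_for /continuous_at -(E _ w0).
apply: cvg_trans cg; apply: near_eq_cvg.
near=> v; apply/E; near: v; exact: lt_nbhsr.
Unshelve. all: by end_near. Qed.

Lemma cdf_is_derive (w : R) : 0 < w -> is_derive w 1 F (f w).
Proof. by move=> w0; apply: (is_derive_cdf Ff); exact: density_continuous. Qed.

End baseline.

(** * Derivatives of products and sums *)

Lemma is_derive_prod (R : realType) (I : Type) (s : seq I) (a : I -> R -> R)
    (a' : I -> R) (x : R) :
  (forall i, a i x != 0) -> (forall i, is_derive x 1 (a i) (a' i)) ->
  is_derive x 1 (fun y => \prod_(i <- s) a i y)
    (\prod_(i <- s) a i x * \sum_(i <- s) a' i / a i x).
Proof.
move=> a0 da; elim: s => [|i s IH].
  rewrite !big_nil mulr0; under eq_fun do rewrite big_nil; exact: is_derive_cst.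
rewrite !big_cons; under eq_fun do rewrite big_cons.
apply: (is_derive_eq (is_deriveM (da i) IH)).
by rewrite /GRing.scale/=; field.
Qed.

Lemma is_derive_sum_fun (R : realType) (n : nat) (a : 'I_n -> R -> R)
    (a' : 'I_n -> R) (x : R) :
  (forall i, is_derive x 1 (a i) (a' i)) ->
  is_derive x 1 (fun y => \sum_i a i y) (\sum_i a' i).
Proof.
move=> da; have := is_derive_sum da; congr is_derive.
by apply/funext => y; rewrite fct_sumE.
Qed.

Lemma is_derive_affine (R : realType) (k : R -> R) (k' l th x : R) :
  is_derive ((x - l) / th) 1 k k' ->
  is_derive x 1 (fun y => k ((y - l) / th)) (k' / th).
Proof.
move=> dk; apply: (@is_derive1_comp _ k (fun y => (y - l) / th)) => //.
have -> : (fun y : R => (y - l) / th) = th^-1 \*: (id - cst l).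
  by apply/funext => y /=; rewrite /GRing.scale/= mulrC.
apply: is_derive_eq; rewrite subr0 /GRing.scale/= mulr1//.
Qed.

(** * The reversed hazard rate of the second-largest order statistic *)

Lemma prod_add_sum_skip (R : comRingType) (n : nat) (p k : 'I_n -> R) :
  \prod_i p i + \sum_i (p i * k i) * \prod_(j | j != i) p j =
  \prod_i p i * (1 + \sum_i k i).
Proof.
rewrite mulrDr mulr1; congr +%R; rewrite mulr_sumr.
by apply: eq_bigr => i _; rewrite [in RHS](bigD1 i)//= mulrAC.
Qed.

Section second_largest_ELS.
Context (R : realType) (F f : R -> R).
Context (Ff : nonneg_abs_continuous F f).
Notation h := (hazard_ratio F f).
Context (dh : forall w : R, 0 < w -> derivable h w 1).
Context (h_dec : {in `]0, +oo[ &, nonincreasing_fun (fun w : R =>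
  w ^+ 2 * derive1 h w)}).
Context (dr : forall w : R, 0 < w ->
  derivable (fun v : R => v * reversed_hazard_rate F f v) w 1).
Context d (T : measurableType d) (P : probability T R).
Context (n : nat) (X : 'I_n -> {RV P >-> R}) (l : R) (theta : 'I_n -> R).
Context (indX : independent_components X).
Context (n2 : (2 <= n)%N).
Context (X_ELS : is_ELS X (fun=> l) theta (fun=> 1) F).

Let theta0 i : 0 < theta i. Proof. by have [] := X_ELS.1 i. Qed.

Let cdf_X i x : l < x -> real_cdf (X i) x = F ((x - l) / theta i).
Proof.
move=> lx; rewrite X_ELS.2 lx powRr1//.
by have /andP[] := cdf_bounds Ff ((x - l) / theta i).
Qed.

(** Every term contains at least n - 1 >= 1 vanishing factors. *)
Lemma second_largest_cdf_left x : x <= l ->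
  real_cdf (order_statistic n.-1 X) x = 0.
Proof.
move=> xl; rewrite second_largest_cdf//.
have X0 i : real_cdf (X i) x = 0 by rewrite X_ELS.2 ltNge xl.
have -> : \prod_i real_cdf (X i) x = 0.
  by rewrite (bigD1 (Ordinal (ltnW n2)))//= X0 mul0r.
rewrite add0r big1// => i _.
rewrite (eq_bigr (fun=> 0)) => [|j _]; last exact: X0.
rewrite prodr_const cardC1 card_ord.
by case: n n2 => [|[|m]]//= _; rewrite expr0n mulr0.
Qed.

Let wpos x i : l < x -> 0 < (x - l) / theta i.
Proof. by move=> lx; rewrite divr_gt0// subr_gt0. Qed.

(** Each 1 - F factors as F h, which brings out the product of all the F. *)
Lemma second_largest_cdf_right x : l < x ->
  real_cdf (order_statistic n.-1 X) x =
  \prod_i F ((x - l) / theta i) * (1 + \sum_i h ((x - l) / theta i)).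
Proof.
move=> lx; rewrite second_largest_cdf// -prod_add_sum_skip.
congr +%R; first by apply: eq_bigr => i _; rewrite cdf_X.
apply: eq_bigr => i _; rewrite cdf_X// -hazard_ratio_cdf//; last exact: wpos.
by congr *%R; apply: eq_bigr => j _; rewrite cdf_X.
Qed.

(** The logarithmic derivative of prod_i F (w_i) * (1 + sum_i h (w_i)); the
    inner derivative 1 / theta i of w_i is w_i / (x - l), whence the factor
    1 / (x - l) in front of functions of the w_i alone. *)
Lemma second_largest_rh x : l < x ->
  reversed_hazard_rate (real_cdf (order_statistic n.-1 X))
    (derive1 (real_cdf (order_statistic n.-1 X))) x =
  (\sum_i ((x - l) / theta i * reversed_hazard_rate F f ((x - l) / theta i)) +
   (\sum_i ((x - l) / theta i * derive1 h ((x - l) / theta i))) /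
   (1 + \sum_i h ((x - l) / theta i))) / (x - l).
Proof.
move=> lx; pose w i := (x - l) / theta i.
have w0 i : 0 < w i by exact: wpos.
pose p y := \prod_i F ((y - l) / theta i).
pose q y := 1 + \sum_i h ((y - l) / theta i).
have dp : is_derive x 1 p (p x * \sum_i (f (w i) / theta i) / F (w i)).
  apply: is_derive_prod => i.
    by rewrite gt_eqF// (cdf_gt0 Ff dh h_dec (w0 i)).
  by apply: is_derive_affine; exact: (cdf_is_derive Ff dh h_dec dr (w0 i)).
have dq : is_derive x 1 q (\sum_i derive1 h (w i) / theta i).
  rewrite -[X in is_derive _ _ _ X]add0r.
  have -> : q = cst 1 + (fun y => \sum_i h ((y - l) / theta i)) by [].
  apply: is_deriveD.
  apply: is_derive_sum_fun => i; apply: is_derive_affine.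
  by rewrite derive1E; exact/derivableP/dh/w0.
have E (y : R) : l < y -> (p * q) y = real_cdf (order_statistic n.-1 X) y.
  by move=> ly; rewrite second_largest_cdf_right.
have p0 : 0 < p x.
  by apply: prodr_gt0 => i _; exact: (cdf_gt0 Ff dh h_dec (w0 i)).
have q0 : 0 < q x.
  by rewrite ltr_pwDl// sumr_ge0// => i _; exact: hazard_ratio_ge0.
have [_ dG] : is_derive x 1 (real_cdf (order_statistic n.-1 X))
    (p x *: (\sum_i derive1 h (w i) / theta i) +
     q x *: (p x * \sum_i (f (w i) / theta i) / F (w i))).
  apply: near_eq_is_derive (is_deriveM dp dq).
  by near=> y; apply: E; near: y; exact: lt_nbhsr.
rewrite {1}/reversed_hazard_rate derive1E dG -E//.
have t0 : x - l != 0 by rewrite subr_eq0 gt_eqF.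
have -> : \sum_i (x - l) / theta i *
      reversed_hazard_rate F f ((x - l) / theta i) =
    (x - l) * \sum_i f (w i) / theta i / F (w i).
  rewrite mulr_sumr; apply: eq_bigr => i _; rewrite /reversed_hazard_rate.
  by rewrite -/(w i) /w -!mulrA; congr *%R; rewrite mulrCA.
have -> : \sum_i (x - l) / theta i * derive1 h ((x - l) / theta i) =
    (x - l) * \sum_i derive1 h (w i) / theta i.
  rewrite mulr_sumr; apply: eq_bigr => i _.
  by rewrite -mulrA; congr *%R; rewrite mulrC.
rewrite -/(q x) /GRing.scale/=. rewrite [(p * q) x](_ : _ = p x * q x)//.
by field; rewrite t0 !gt_eqF.
Unshelve. all: by end_near. Qed.

End second_largest_ELS.

(** * The comparison *)

(** Subtracting a small multiple of the identity makes the function strictly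
    decreasing, at the cost of a small change in the derivative. *)
Lemma nonincreasing_derive1_le0 (R : realType) (k : R -> R) (w : R) :
  (forall v : R, 0 < v -> derivable k v 1) ->
  {in `]0, +oo[ &, nonincreasing_fun k} -> 0 < w -> derive1 k w <= 0.
Proof.
move=> dk k_dec w0; apply/ler_addgt0Pr => e e0; rewrite add0r -subr_le0.
have dke (v : R) : 0 < v -> is_derive v 1 (k - e \*: id) (derive1 k v - e).
  move=> v0; have dkv : is_derive v 1 k (derive1 k v).
    by rewrite derive1E; exact/derivableP/dk.
  by apply: is_derive_eq; rewrite /GRing.scale/= mulr1.
have [_ <-] := dke _ w0; rewrite -derive1E.
apply: (@decr_derive1_le0_itvy _ _ false 0) => [v|u v u0 v0 uv|].
- by rewrite inE/= in_itv/= andbT => /dke[].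
- by apply: ler_ltD; [exact: k_dec (ltW uv)|rewrite ltrN2 /= ltr_pM2l].
- by rewrite in_itv/= w0.
Qed.

Theorem theorem3p4 (R : realType)
  (d : measure_display) (T : measurableType d) (P : probability T R)
  (d' : measure_display) (T' : measurableType d') (Q : probability T' R)
  (n : nat) (hn : (2 <= n)%N)
  (Fb fb : R -> R) (hFb : nonneg_abs_continuous Fb fb)
  (X : 'I_n -> {RV P >-> R}) (Y : 'I_n -> {RV Q >-> R})
  (lambda theta alpha mu delta beta : 'I_n -> R)
  (hX : is_ELS X lambda theta alpha Fb) (indX : independent_components X)
  (hY : is_ELS Y mu delta beta Fb) (indY : independent_components Y)
  (l : R) (hl : 0 < l)
  (hlambda : lambda = (fun=> l)) (hmu : mu = (fun=> l))
  (halpha : alpha = (fun=> 1)) (hbeta : beta = (fun=> 1))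
  (hDE : (D_plus theta /\ D_plus delta) \/ (E_plus theta /\ E_plus delta))
  (der1 : forall w : R, 0 < w ->
     derivable (fun v : R => v * reversed_hazard_rate Fb fb v) w 1)
  (der2 : forall w : R, 0 < w -> derivable (hazard_ratio Fb fb) w 1)
  (der3 : forall w : R, 0 < w ->
     derivable (fun v : R => v * derive1 (hazard_ratio Fb fb) v) w 1)
  (dec1 : {in `]0, +oo[ &, nonincreasing_fun (fun w : R =>
     w ^+ 2 * derive1 (fun v : R => v * reversed_hazard_rate Fb fb v) w)})
  (dec2 : {in `]0, +oo[ &, nonincreasing_fun (hazard_ratio Fb fb)})
  (dec3 : {in `]0, +oo[ &, nonincreasing_fun (fun w : R =>
     w ^+ 2 * derive1 (hazard_ratio Fb fb) w)})
  (dec4 : {in `]0, +oo[ &, nonincreasing_fun (fun w : R =>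
     w ^+ 2 * derive1 (fun v : R => v * derive1 (hazard_ratio Fb fb) v) w)}) :
  majorizes theta delta ->
  rh_le (order_statistic n.-1 X) (order_statistic n.-1 Y).
Proof.
move=> maj x _ [_ FX] _.
subst lambda mu alpha beta.
have theta0 i : 0 < theta i by have [] := hX.1 i.
have delta0 i : 0 < delta i by have [] := hY.1 i.
(* At or left of l the distribution function vanishes, and the reversed hazard
   rate is undefined. *)
have lx : l < x.
  rewrite ltNge; apply/negP => xl.
  by rewrite (second_largest_cdf_left indX hn hX xl) ltxx in FX.
have t0 : 0 < x - l by rewrite subr_gt0.
rewrite (second_largest_rh hFb der2 dec3 der1 indX hn hX lx).
rewrite (second_largest_rh hFb der2 dec3 der1 indY hn hY lx).
rewrite ler_pM2r ?invr_gt0//.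
have hA := majorizes_scale_sum t0 der1 dec1 delta0 theta0 maj.
have hB := majorizes_scale_sum t0 der3 dec4 delta0 theta0 maj.
have hC := majorizes_scale_sum t0 der2 dec3 delta0 theta0 maj.
have C0 (th : 'I_n -> R) :
    0 < 1 + \sum_i hazard_ratio Fb fb ((x - l) / th i).
  by rewrite ltr_pwDl// sumr_ge0// => i _; exact: hazard_ratio_ge0.
have B0 : \sum_i ((x - l) / delta i *
    derive1 (hazard_ratio Fb fb) ((x - l) / delta i)) <= 0.
  apply: sumr_le0 => i _; have w0 : 0 < (x - l) / delta i by rewrite divr_gt0.
  rewrite pmulr_rle0//.
  exact: nonincreasing_derive1_le0.
apply: lerD => //.
(* First enlarge the numerator over the positive denominator, then enlarge the
   denominator under the nonpositive numerator. *)
apply: (le_trans (ler_wpM2r _ hB)); first by rewrite invr_ge0 ltW.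
by apply: ler_wnM2l => //; rewrite lef_pV2 ?posrE// lerD2l.
Qed.
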